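(* Let $p$ be an odd prime, $q$ a power of $p$, $l\ge0$ an integer, $n=p^l+2$, and $k$ an integer with $0\le k\le p-1$ and $k\neq 0,2,4$. Then $D_{n,k}(1,x)$ is a permutation polynomial of $\mathbb{F}_q$ if and only if the trinomial $(4-k)\,x^{\frac{p^l+1}{2}}+k\,x^{\frac{p^l-1}{2}}+(2-k)x$ is a permutation polynomial of $\mathbb{F}_q$.
   Context: For an integer $n\ge1$, $D_{n,k}(1,x)=\sum_{i=0}^{\lfloor n/2\rfloor}\frac{n-ki}{n-i}\binom{n-i}{i}(-x)^i\in\mathbb{F}_q[x]$ (the coefficients are integers, reduced mod $p$). A permutation polynomial of $\mathbb{F}_q$ is a polynomial inducing a bijection of $\mathbb{F}_q$. *)

(* Defs.v *)
From HB Require Import structures.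
From mathcomp Require Import all_boot all_order all_algebra all_field.

Set Implicit Arguments.
Unset Strict Implicit.
Unset Printing Implicit Defensive.

Import Order.TTheory GRing.Theory Num.Theory.

Local Open Scope ring_scope.

(* The division is exact for 0 < n and i <= n./2, see rdickson_coefE. *)
Definition rdickson_coef (n k i : nat) : int :=
  (((n%:Z - k%:Z * i%:Z) * 'C(n - i, i)%:Z) %/ (n - i)%N%:Z)%Z.

(* Reversed Dickson polynomial D_{n,k}(1,x) of the (k+1)-th kind. *)
Definition rdickson (R : nzRingType) (n k : nat) : {poly R} :=
  \sum_(0 <= i < (n./2).+1) (rdickson_coef n k i)%:~R *: (- 'X) ^+ i.

Definition permutation_poly (F : finFieldType) (f : {poly F}) : Prop :=
  bijective (fun x : F => f.[x]).

Lemma rdickson_coef_dvd (n k i : nat) : (0 < n)%N -> (i <= n./2)%N ->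
  ((n - i)%N%:Z %| (n%:Z - k%:Z * i%:Z) * 'C(n - i, i)%:Z)%Z.
Proof.
move=> n_gt0 le_i_n2.
have le_i_n : (i <= n)%N.
  by apply: leq_trans le_i_n2 _; rewrite leq_half_double leqW // -muln2 leq_pmulr.
have -> : n%:Z - k%:Z * i%:Z = (n - i)%N%:Z + (1 - k%:Z) * i%:Z.
  by rewrite -subzn // mulrBl mul1r addrA subrK.
rewrite mulrDl; apply: rpredD; first exact: dvdz_mulr.
rewrite -mulrA; apply: dvdz_mull; rewrite -PoszM.
case: i {le_i_n2} le_i_n => [|i] le_i_n; first by rewrite mul0n dvdz0.
case: (n - i.+1)%N => [|m]; first by rewrite bin0n muln0.
by rewrite -mul_bin_diag PoszM dvdz_mulr.
Qed.

Lemma rdickson_coefE (n k i : nat) : (0 < n)%N -> (i <= n./2)%N ->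
  (rdickson_coef n k i)%:~R =
    (n%:R - k%:R * i%:R) / (n%:R - i%:R) * 'C(n - i, i)%:R :> rat.
Proof.
move=> n_gt0 le_i_n2.
have lt_i_n : (i < n)%N.
  apply: leq_ltn_trans le_i_n2 _.
  by rewrite ltn_half_double -muln2 ltn_Pmulr.
have nz : (n%:R - i%:R : rat) != 0 by rewrite subr_eq0 eqr_nat gtn_eqF.
apply: (mulIf nz); rewrite mulrAC divfK // -natrB ?(ltnW lt_i_n) //.
rewrite -[(n - i)%:R]/(((n - i)%N%:Z)%:~R) -intrM.
by rewrite divzK ?rdickson_coef_dvd // intrM intrB intrM.
Qed.

(* Main.v *)
(** If y + z = 1, then (y - z) D_{n,k}(1, y z) is a combination of the powers
  of y and z, by the Binet formula for sum_i C(n-i,i) (-yz)^i. For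
  y = (1 + u)/2, z = (1 - u)/2 and n = p^l + 2 the Frobenius map evaluates
  these powers, which gives, with w = u^2 = 1 - 4x,
    8 D_{n,k}(1,x) = T(w) + (2 + k)
  where T is the trinomial. So T and D_{n,k}(1, .) differ by affine bijections.
  Taking u to be an indeterminate avoids adjoining square roots to F. *)

Require Import Defs.
From HB Require Import structures.
From mathcomp Require Import all_boot all_order all_algebra all_field.
From mathcomp Require Import ring.

Set Implicit Arguments.
Unset Strict Implicit.
Unset Printing Implicit Defensive.

Import Order.TTheory GRing.Theory Num.Theory.

Local Open Scope ring_scope.

Lemma rdickson_coef0 (n k : nat) : (0 < n)%N -> rdickson_coef n k 0 = 1.
Proof.
move=> n_gt0; rewrite /rdickson_coef mulr0 !subr0 subn0 bin0 mulr1 divzz.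
by rewrite eqz_nat -lt0n n_gt0.
Qed.

(** The numerator splits as [(n - i.+1) + (1 - k) * i.+1], and the absorption identity for binomials
    makes the division exact in the second part too. *)
Lemma rdickson_coefS (n k i : nat) : (i.+1 < n)%N ->
  rdickson_coef n k i.+1
    = 'C(n - i.+1, i.+1)%:Z + (1 - k%:Z) * 'C(n - i.+2, i)%:Z.
Proof.
move=> lt_in; rewrite /rdickson_coef.
have -> : n%:Z - k%:Z * i.+1%:Z = (n - i.+1)%N%:Z + (1 - k%:Z) * i.+1%:Z.
  by rewrite -subzn ?(ltnW lt_in) // mulrBl mul1r addrA subrK.
have [m def_m] : exists m, (n - i.+1 = m.+1)%N.
  by exists (n - i.+1).-1; rewrite prednK // subn_gt0.
have -> : (n - i.+2 = m)%N by rewrite subnS def_m.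
rewrite def_m mulrDl -mulrA -(PoszM i.+1) -mul_bin_diag PoszM mulrCA -mulrDr mulrC.
by rewrite mulzK.
Qed.

(** Both sides satisfy [a m.+2 = a m.+1 - y * z * a m]: the left by Pascal's rule, the right because
    [y] and [z] are the roots of [t^2 - t + y * z]. Terms beyond [n./2] vanish, so the length [N] is
    free and can follow the recurrence. *)
Lemma sum_bin_diff_pow (R : comPzRingType) (y z : R) (n N : nat) :
  y + z = 1 -> (n./2 < N)%N ->
  (y - z) * (\sum_(0 <= i < N) 'C(n - i, i)%:R * (- (y * z)) ^+ i)
    = y ^+ n.+1 - z ^+ n.+1.
Proof.
move=> yz1.
pose E n N := \sum_(0 <= i < N) 'C(n - i, i)%:R * (- (y * z)) ^+ i.
have E_rec m M : E m.+2 M.+1 = E m.+1 M.+1 - y * z * E m M.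
  rewrite /E !big_nat_recl // !subn0 !bin0 -addrA mulr_sumr -sumrN -big_split.
  congr (_ + _); apply: eq_bigr => i _ /=.
  rewrite !subSS exprS; have [le_im | lt_mi] := leqP i m.
    by rewrite subSn // binS natrD; move: (_ ^+ i) => t; ring.
  (* Pascal's rule fails under truncated subtraction, but here all three binomials are ['C(0, j)]
     with [j > 0]. *)
  have /eqP -> : (m.+1 - i == 0)%N by rewrite subn_eq0.
  have /eqP -> : (m - i == 0)%N by rewrite subn_eq0 ltnW.
  by case: i lt_mi => // i _; rewrite !bin0n !mul0r mulr0 subr0.
have yE : y = 1 - z by rewrite -yz1 addrK.
rewrite -/(E n N); elim/ltn_ind: n N => -[|[|n]] IHn [|N] //.
- rewrite /E big_nat_recl // big1 => [_|i _]; last by rewrite sub0n bin0n mul0r.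
  by rewrite bin0; ring.
- rewrite /E big_nat_recl // big1 => [_|i _]; last by rewrite subSS sub0n bin0n mul0r.
  by rewrite bin0 yE; ring.
rewrite /= ltnS => ltnN; rewrite E_rec mulrBr mulrCA !IHn //.
  by rewrite !exprS yE; ring.
by rewrite ltnS -[n.+1./2]/(uphalf n) uphalf_half (leq_trans _ ltnN) // -add1n leq_add2r leq_b1.
Qed.

(** By [rdickson_coefS], the Dickson polynomial is the binomial sum for [n.+2] minus [(1 - k) * x]
    times the one for [n]; the Binet formula applies to each. *)
Lemma rdickson_comp_mul (R : comNzRingType) (n k : nat) (y z : {poly R}) :
  y + z = 1 ->
  (y - z) * (rdickson R n.+2 k \Po (y * z))
    = y ^+ n.+3 - z ^+ n.+3 - (1 - k%:R) * (y * z) * (y ^+ n.+1 - z ^+ n.+1).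
Proof.
move=> yz1.
have lt_half : (n.+2./2 < n./2.+2)%N by [].
(* The second sum is taken one term shorter, so that the two match termwise once the constant term
   of the first is split off. *)
rewrite -(sum_bin_diff_pow yz1 lt_half) -(sum_bin_diff_pow yz1 (ltnSn n./2)).
rewrite mulrCA -mulrBr; congr (_ * _).
rewrite /rdickson linear_sum big_nat_recl // [in RHS]big_nat_recl //=.
rewrite rdickson_coef0 // scale1r bin0 !expr0 comp_polyC mulr1 -addrA.
congr (_ + _); rewrite mulr_sumr -sumrB; apply: eq_big_nat => i /andP[_ lt_i].
have lt_in : (i.+1 < n.+2)%N.
  by rewrite ltnS (leq_trans lt_i) // ltnS leq_half_double leqW // -addnn leq_addr.
rewrite rdickson_coefS // !subSS comp_polyZ rmorphXn rmorphN /= comp_polyX.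
rewrite -mul_polyC !rmorph_int rmorphD rmorphM rmorphB /= !exprS.
rewrite -!pmulrn; ring.
Qed.

(** Meant for [w = x ^+ (p ^ l - 1)], where Frobenius turns [c * (1 + x * w)] and [c * (1 - x * w)]
    into the [p ^ l]-th powers of [y] and [z]. *)
Lemma half_cube_identity (R : comPzRingType) (c x w k : R) :
  c * 2%:R = 1 ->
  let y := c * (1 + x) in let z := c * (1 - x) in
  8%:R * (y ^+ 3 * (c * (1 + x * w)) - z ^+ 3 * (c * (1 - x * w))
    - (1 - k) * (y * z) * (y * (c * (1 + x * w)) - z * (c * (1 - x * w))))
  = x * ((4%:R - k) * (x ^+ 2 * w) + k * w + (2%:R - k) * x ^+ 2 + (2%:R + k)).
Proof.
(* The left side is homogeneous of degree 4 in [c]; scaling the right side by [(c * 2) ^+ 4] leaves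
   a plain ring identity. *)
move=> c2 y z; have c2_4 : (c * 2%:R) ^+ 4 = 1 by rewrite c2 expr1n.
by rewrite -[RHS]mul1r -[X in _ = X * _]c2_4 /y /z; ring.
Qed.

Lemma rdickson_pow_add2 (F : fieldType) (p l k : nat) :
  p \in [pchar F] -> odd p ->
  8%:R *: (rdickson F (p ^ l + 2) k \Po (4%:R^-1 *: (1 - 'X)))
    = (4%:R - k%:R) *: 'X^((p ^ l + 1) %/ 2) + k%:R *: 'X^((p ^ l - 1) %/ 2)
      + (2%:R - k%:R) *: 'X + (2%:R + k%:R)%:P.
Proof.
move=> pcharF p_odd.
have p_prime : prime p by apply: pcharf_prime pcharF.
have two_neq0 : 2%:R != 0 :> F.
  by rewrite -(dvdn_pcharf pcharF) dvdn_prime2 //; apply: contraL p_odd => /eqP->.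
have [a def_a] : exists a, (p ^ l = a.*2.+1)%N.
  by exists (p ^ l)./2; rewrite -[LHS]odd_double_half oddX p_odd orbT.
rewrite def_a addn1 subn1 /= !divn2 doubleK -doubleS doubleK.
have pcharP : p \in [pchar {poly F}] by rewrite pchar_poly.
have frob (u v : {poly F}) : (u + v) ^+ (p ^ l) = u ^+ (p ^ l) + v ^+ (p ^ l).
  by rewrite exprDn_pchar // pnatX pnatE ?pcharP.
pose c : {poly F} := (2%:R^-1)%:P.
have c2 : c * 2%:R = 1 by rewrite -polyC_natr -polyCM mulVf.
(* One half lies in the prime field, hence is fixed by Frobenius. *)
have c_pow : c ^+ (p ^ l) = c.
  have two_pow : 2%:R ^+ (p ^ l) = 2%:R :> {poly F} by rewrite frob !expr1n.
  have c2_pow : c ^+ (p ^ l) * 2%:R = 1 by rewrite -two_pow -exprMn c2 expr1n.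
  by rewrite -[RHS]mulr1 -c2_pow mulrCA c2 mulr1.
pose y := c * (1 + 'X); pose z := c * (1 - 'X).
have yz1 : y + z = 1 by rewrite -[RHS]c2 /y /z; ring.
have yBz : y - z = 'X by rewrite -[RHS]mul1r -c2 /y /z; ring.
pose W : {poly F} := 'X^2 ^+ a.
have y_pow : y ^+ a.*2.+1 = c * (1 + 'X * W).
  by rewrite -def_a exprMn frob c_pow expr1n def_a exprS -mul2n exprM.
have z_pow : z ^+ a.*2.+1 = c * (1 - 'X * W).
  rewrite -def_a exprMn frob c_pow expr1n exprNn_pchar ?pnatX ?pnatE ?pcharP //.
  by rewrite def_a exprS -mul2n exprM.
have yz : (4%:R^-1 *: (1 - 'X)) \Po 'X^2 = y * z.
  rewrite comp_polyZ comp_polyB comp_polyX comp_polyC -mul_polyC.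
  rewrite (natrM _ 2 2) invfM polyCM -/c /y /z.
  by rewrite polyC1; move: (c) => d; ring.
(* It suffices to compare after substituting the square of the indeterminate and multiplying by
   ['X], which is [y - z]. *)
have comp_inj (A B : {poly F}) : 'X * (A \Po 'X^2) = 'X * (B \Po 'X^2) -> A = B.
  move=> /(mulfI (negbT (polyX_eq0 _))) /eqP.
  rewrite -subr_eq0 -comp_polyB comp_poly_eq0 ?size_polyXn //.
  by rewrite subr_eq0 => /eqP.
apply: comp_inj.
rewrite comp_polyZ -comp_polyA yz !comp_polyD !comp_polyZ comp_polyC !rmorphXn /=.
rewrite comp_polyX -scalerAr -[X in X * (_ \Po _)]yBz addn2 rdickson_comp_mul //.
have pow3 (v : {poly F}) m : v ^+ m.+3 = v ^+ 3 * v ^+ m by rewrite -exprD.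
rewrite !(pow3 _ a.*2.+1) !(exprS _ a.*2.+1) y_pow z_pow.
rewrite -!mul_polyC polyC_natr !polyCB (polyCD 2%:R) !polyC_natr.
have := half_cube_identity 'X W k%:R c2; rewrite /= -/y -/z => ->.
by rewrite -exprS.
Qed.

Theorem theorem2p17 (F : finFieldType) (p e l k : nat)
  (p_prime : prime p) (p_odd : odd p)
  (e_gt0 : (0 < e)%N) (cardF : #|F| = (p ^ e)%N)
  (k_le : (0 <= k <= p - 1)%N)
  (k_neq0 : k <> 0%N) (k_neq2 : k <> 2%N) (k_neq4 : k <> 4%N) :
  permutation_poly (rdickson F (p ^ l + 2) k)
  <-> permutation_poly
        ((4%:R - k%:R) *: 'X^((p ^ l + 1) %/ 2)
         + k%:R *: 'X^((p ^ l - 1) %/ 2)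
         + (2%:R - k%:R) *: 'X : {poly F}).
Proof.
have pcharF : p \in [pchar F] := card_finPcharP cardF p_prime.
have two_neq0 : 2%:R != 0 :> F.
  by rewrite -(dvdn_pcharf pcharF) dvdn_prime2 //; apply: contraL p_odd => /eqP->.
have neq0 m : (2 ^ m)%:R != 0 :> F by rewrite natrX expf_neq0.
set T := (_ + (_ : {poly F})); set D := rdickson _ _ _.
pose f (w : F) := 4%:R^-1 * (1 - w).
pose g (w : F) := 8%:R * w - (2%:R + k%:R).
have f_bij : bijective f.
  exists (fun x : F => 1 - 4%:R * x) => w; rewrite /f.
    by rewrite mulVKf ?(neq0 2) // subKr.
  by rewrite subKr mulKf ?(neq0 2).
have g_bij : bijective g.
  exists (fun w : F => 8%:R^-1 * (w + (2%:R + k%:R))) => w; rewrite /g.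
    by rewrite subrK mulKf ?(neq0 3).
  by rewrite mulVKf ?(neq0 3) // addrK.
(* Evaluating the polynomial identity at [w] gives [8 * D.[f w] = T.[w] + (2 + k)], and [g] solves
   this for [T.[w]]. *)
have T_eq : (fun w : F => T.[w]) =1 g \o ((fun x : F => D.[x]) \o f).
  move=> w; have /(congr1 (horner^~ w)) := rdickson_pow_add2 l k pcharF p_odd.
  rewrite -/T /= hornerZ horner_comp (hornerD T) (hornerZ _ (1 - 'X)).
  rewrite (hornerD 1) hornerN hornerX !hornerC => eq_w.
  by rewrite /g /= eq_w addrK.
split=> perm.
  by apply: eq_bij (fsym T_eq); apply: bij_comp g_bij (bij_comp perm f_bij).
have [f' fK f'K] := f_bij; have [g' gK g'K] := g_bij.
have D_eq : g' \o ((fun w : F => T.[w]) \o f') =1 (fun x : F => D.[x]).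
  by move=> x /=; rewrite [T.[_]]T_eq /= gK f'K.
apply: eq_bij D_eq.
by apply: bij_comp (bij_comp perm _); [exists g | exists f].
Qed.
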